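(* Let $f:(A,P_A)\to(B,P_B)$ be a morphism of commutative Rota-Baxter $\mathbf{k}$-algebras of weight $\lambda$, let $S$ be a multiplicative subset of $A$, and let $T$ be the multiplicative subset $f(S)$ of $B$. Then there is a natural isomorphism of Rota-Baxter algebras $$\big(S^{-1}_{RB}A\overset{RB}{\otimes}_{A}B,\ S^{-1}P_A\otimes_{P_A}P_B\big)\ \stackrel{\cong}{\longrightarrow}\ \big(T^{-1}_{RB}B,\ T^{-1}P_B\big)$$ from the Rota-Baxter tensor product of $(S^{-1}_{RB}A,S^{-1}P_A)$ and $(B,P_B)$ over $(A,P_A)$ to the Rota-Baxter localization of $(B,P_B)$ at $T$.
   Context: $\mathbf{k}$ is a commutative unitary ring, $\lambda\in\mathbf{k}$ is fixed, and all algebras are commutative unital $\mathbf{k}$-algebras. A Rota-Baxter algebra of weight $\lambda$ is a pair $(R,P)$ with $R$ an algebra and $P:R\to R$ a $\mathbf{k}$-linear map satisfying $P(x)P(y)=P(xP(y)+P(x)y+\lambda xy)$ for all $x,y\in R$. A morphism $f:(R,P)\to(R',P')$ is an algebra homomorphism with $f\circ P=P'\circ f$. All Rota-Baxter algebras have the same weight $\lambda$. Rota-Baxter localization: for a multiplicative subset $S\subseteq R$, it is a commutative Rota-Baxter algebra $(S^{-1}_{RB}R,S^{-1}P)$ with a Rota-Baxter homomorphism $i_S:R\to S^{-1}_{RB}R$ such that (1) the elements of $i_S(S)$ are invertible; (2) for every commutative Rota-Baxter algebra $(R',P_{R'})$ and Rota-Baxter homomorphism $f:R\to R'$ such that $f(S)$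 consists of invertible elements, there is a unique Rota-Baxter homomorphism $f_S:S^{-1}_{RB}R\to R'$ with $f_S\circ i_S=f$. It exists and is unique up to isomorphism. The Rota-Baxter tensor product $(R_1\overset{RB}{\otimes}_{R_0}R_2,P_{R_1}\otimes_{P_{R_0}}P_{R_2})$ of a diagram $(R_1,P_{R_1})\leftarrow(R_0,P_{R_0})\to(R_2,P_{R_2})$ is its colimit (pushout) in the category of commutative Rota-Baxter $\mathbf{k}$-algebras of weight $\lambda$; it always exists. Here it is formed along $i_S:A\to S^{-1}_{RB}A$ and $f:A\to B$. *)

(* Defs.v *)
From HB Require Import structures.
From mathcomp Require Import all_boot all_algebra classical_sets.

Set Implicit Arguments.
Unset Strict Implicit.
Unset Printing Implicit Defensive.

Import GRing.Theory.
Local Open Scope ring_scope.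
Local Open Scope classical_set_scope.

(* [comAlgType k] is not used: it forbids 1 = 0, whereas the zero algebra is an
   algebra here (it is, for instance, the localization at a set containing 0).
   A commutative k-algebra is a commutative ring R with a ring morphism k -> R,
   the scalar action of [a] on [x] being [alg_unit a * x]. *)
HB.mixin Record ComPzRing_isAlgebra (k : comPzRingType) R
    of GRing.ComPzRing R := {
  alg_unit : {rmorphism k -> R}
}.

#[short(type="comPzAlgType")]
HB.structure Definition ComPzAlgebra (k : comPzRingType) :=
  {R of GRing.ComPzRing R & ComPzRing_isAlgebra k R}.

Definition alg_scale (k : comPzRingType) (R : comPzAlgType k) (a : k) (x : R) : R :=
  alg_unit a * x.

Notation "a *:k x" := (alg_scale a x) (at level 40) : ring_scope.

HB.mixin Record ComPzAlgebra_isRotaBaxter (k : comPzRingType) (lambda : k) R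
    of ComPzAlgebra k R := {
  rbop : R -> R;
  rbopD : forall x y : R, rbop (x + y) = rbop x + rbop y;
  rbopZ : forall (a : k) (x : R), rbop (a *:k x) = a *:k rbop x;
  rbopM : forall x y : R,
    rbop x * rbop y = rbop (x * rbop y + rbop x * y + lambda *:k (x * y))
}.

#[short(type="comRBAlgType")]
HB.structure Definition ComRotaBaxter (k : comPzRingType) (lambda : k) :=
  {R of ComPzAlgebra k R & ComPzAlgebra_isRotaBaxter k lambda R}.

Record rb_hom (k : comPzRingType) (lambda : k) (R R' : comRBAlgType lambda) :=
  RBHom {
    rb_fun :> {rmorphism R -> R'};
    rb_homZ : forall (a : k) (x : R), rb_fun (a *:k x) = a *:k rb_fun x;
    rb_homP : forall x : R, rb_fun (rbop x) = rbop (rb_fun x)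
  }.

Section RotaBaxter.
Context {k : comPzRingType} {lambda : k}.
Implicit Types R Q A B : comRBAlgType lambda.

Definition rb_iso R R' (phi : rb_hom R R') : Prop :=
  exists psi : rb_hom R' R, cancel phi psi /\ cancel psi phi.

Definition mult_subset R (S : set R) : Prop :=
  S 1 /\ forall x y, S x -> S y -> S (x * y).

Lemma mult_subset_image A B (f : rb_hom A B) (S : set A) :
  mult_subset S -> mult_subset (f @` S).
Proof.
case=> S1 SM; split; first by exists 1 => //; rewrite rmorph1.
by move=> _ _ [x Sx <-] [y Sy <-]; exists (x * y); [exact: SM | rewrite rmorphM].
Qed.

Definition invertible R (x : R) : Prop := exists y : R, x * y = 1.

Definition is_rb_localization A (S : set A) L (i : rb_hom A L) : Prop :=
  (forall s, S s -> invertible (i s)) /\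
  forall R' (f : rb_hom A R'), (forall s, S s -> invertible (f s)) ->
    exists g : rb_hom L R', g \o i =1 f /\
      forall h : rb_hom L R', h \o i =1 f -> h =1 g.

Record rb_localization A (S : set A) := RBLocalization {
  loc_alg :> comRBAlgType lambda;
  loc_map : rb_hom A loc_alg;
  loc_mapP : is_rb_localization S loc_map
}.

Definition is_rb_tensor R0 R1 R2 (f1 : rb_hom R0 R1) (f2 : rb_hom R0 R2)
    Q (j1 : rb_hom R1 Q) (j2 : rb_hom R2 Q) : Prop :=
  j1 \o f1 =1 j2 \o f2 /\
  forall R' (g1 : rb_hom R1 R') (g2 : rb_hom R2 R'), g1 \o f1 =1 g2 \o f2 ->
    exists g : rb_hom Q R', [/\ g \o j1 =1 g1, g \o j2 =1 g2 &
      forall h : rb_hom Q R', h \o j1 =1 g1 -> h \o j2 =1 g2 -> h =1 g].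

Record rb_tensor R0 R1 R2 (f1 : rb_hom R0 R1) (f2 : rb_hom R0 R2) := RBTensor {
  tensor_alg :> comRBAlgType lambda;
  tensor_inl : rb_hom R1 tensor_alg;
  tensor_inr : rb_hom R2 tensor_alg;
  tensorP : is_rb_tensor f1 f2 tensor_inl tensor_inr
}.

(* The first equation says that [phi] restricts on the left factor to the map
   induced on localizations by [f], by the universal property of [SA]. *)
Definition compatible A B (f : rb_hom A B) (S : set A)
    (SA : rb_localization S) (TB : rb_localization (f @` S))
    (Q : rb_tensor (loc_map SA) f) (phi : rb_hom Q TB) : Prop :=
  phi \o tensor_inl Q \o loc_map SA =1 loc_map TB \o f /\
  phi \o tensor_inr Q =1 loc_map TB.

End RotaBaxter.

(* Main.v *)
Require Import Defs.
From HB Require Import structures.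
From mathcomp Require Import all_boot all_algebra classical_sets.

Set Implicit Arguments.
Unset Strict Implicit.
Unset Printing Implicit Defensive.

Import GRing.Theory.
Local Open Scope ring_scope.
Local Open Scope classical_set_scope.

(** Both sides solve the same universal problem. A morphism out of the tensor
    product restricts to a morphism [g] out of [B] and to one out of the
    localization of [A] that agrees with [g \o f] on [A]. By the universal
    property of the localization, the latter exists exactly when [g \o f] sends
    [S] to invertible elements, that is, when [g] inverts [f @` S], and it is
    then determined by [g]. So the right coprojection [tensor_inr] out of [B]
    is itself a localization of [B] at [f @` S] ([tensor_inr_localization]),
    and the isomorphism is the canonical comparison of two localizations of [B]
    ([rb_localization_iso]).

    Uniqueness and naturality then hold because morphisms out of a localization
    of [B] are determined by their restrictions to [B] ([rb_localization_epi]),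
    where the required equations are immediate. *)

Section RotaBaxterHoms.
Context {k : comPzRingType} {lambda : k}.
Implicit Types R A B L : comRBAlgType lambda.

Lemma idfun_homZ R (a : k) (x : R) : idfun (a *:k x) = a *:k idfun x.
Proof. by []. Qed.

Lemma idfun_homP R (x : R) : idfun (rbop x) = rbop (idfun x).
Proof. by []. Qed.

Definition rb_id R : rb_hom R R := @RBHom k lambda R R idfun
  (@idfun_homZ R) (@idfun_homP R).

Lemma comp_homZ A B R (g : rb_hom B R) (f : rb_hom A B) (a : k) (x : A) :
  (g \o f) (a *:k x) = a *:k (g \o f) x.
Proof. by rewrite /= !rb_homZ. Qed.

Lemma comp_homP A B R (g : rb_hom B R) (f : rb_hom A B) (x : A) :
  (g \o f) (rbop x) = rbop ((g \o f) x).
Proof. by rewrite /= !rb_homP. Qed.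

Definition rb_comp A B R (g : rb_hom B R) (f : rb_hom A B) : rb_hom A R :=
  @RBHom k lambda A R (g \o f) (comp_homZ g f) (comp_homP g f).

Lemma rb_hom_invertible A B (f : rb_hom A B) (x : A) :
  invertible x -> invertible (f x).
Proof. by case=> y xy1; exists (f y); rewrite -rmorphM xy1 rmorph1. Qed.

Lemma rb_localization_epi A (S : set A) L (i : rb_hom A L)
    (iP : is_rb_localization S i) R (g h : rb_hom L R) :
  g \o i =1 h \o i -> g =1 h.
Proof.
case: iP => iS iU gh.
have hS s : S s -> invertible (rb_comp h i s).
  by move=> Ss; exact: (rb_hom_invertible h (iS s Ss)).
have [u [_ uU]] := iU R (rb_comp h i) hS.
by move=> x; rewrite (uU g) // (uU h).
Qed.

Lemma rb_localization_iso A (S : set A) L L' (i : rb_hom A L)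
    (i' : rb_hom A L') (phi : rb_hom L L') :
  is_rb_localization S i -> is_rb_localization S i' ->
  phi \o i =1 i' -> rb_iso phi.
Proof.
move=> iP i'P phiE; have [psi [psiE _]] := i'P.2 L i iP.1.
exists psi; split.
- apply: (rb_localization_epi iP (g := rb_comp psi phi) (h := rb_id L)) => x.
  by have /= -> := phiE x; exact: psiE.
- apply: (rb_localization_epi i'P (g := rb_comp phi psi) (h := rb_id L')) => x.
  by have /= -> := psiE x; exact: phiE.
Qed.

End RotaBaxterHoms.

Section TensorOfLocalization.
Context {k : comPzRingType} {lambda : k} {A B : comRBAlgType lambda}.
Context {f : rb_hom A B} {S : set A} {SA : rb_localization S}.
Variable Q : rb_tensor (loc_map SA) f.

(** Both coprojections agree on [A], so two morphisms that agree on [B] also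
    agree on [A], hence on its localization, and the two factors together
    determine a morphism out of the tensor product. *)
Lemma tensor_inr_epi (R : comRBAlgType lambda) (g h : rb_hom Q R) :
  g \o tensor_inr Q =1 h \o tensor_inr Q -> g =1 h.
Proof.
move=> ghr; have [QE QU] := tensorP Q.
have ghl : g \o tensor_inl Q =1 h \o tensor_inl Q.
  apply: (rb_localization_epi (loc_mapP SA) (g := rb_comp g (tensor_inl Q))
    (h := rb_comp h (tensor_inl Q))) => x /=.
  by have /= -> := QE x; exact: ghr.
have hE : rb_comp h (tensor_inl Q) \o loc_map SA
    =1 rb_comp h (tensor_inr Q) \o f.
  by move=> x /=; have /= -> := QE x.
have [u [_ _ uU]] := QU R _ _ hE.
by move=> x; rewrite (uU g) // (uU h).
Qed.

(** Localizations are stable under pushout: a morphism [g] out of [B] that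
    inverts [f @` S] makes [g \o f] invert [S], so [g \o f] extends to the
    localization of [A] and this extension glues with [g]. *)
Lemma tensor_inr_localization : is_rb_localization (f @` S) (tensor_inr Q).
Proof.
have [QE QU] := tensorP Q; have [iS iU] := loc_mapP SA.
split=> [_ [s Ss <-]|R g gT].
  by have /= <- := QE s; exact: (rb_hom_invertible _ (iS s Ss)).
have gfS s : S s -> invertible (rb_comp g f s).
  by move=> Ss; apply: gT; exists s.
have [gl [glE _]] := iU R (rb_comp g f) gfS.
have [u [_ ur _]] := QU R gl g glE.
by exists u; split=> // h hr; apply: tensor_inr_epi => x; rewrite hr ur.
Qed.

(** The condition on the left factor only concerns the image of [A], where the
    two coprojections agree. *)
Lemma compatible_inr (TB : rb_localization (f @` S)) (phi : rb_hom Q TB) :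
  phi \o tensor_inr Q =1 loc_map TB -> compatible phi.
Proof.
move=> phir; split=> // x /=.
by have /= -> := (tensorP Q).1 x; exact: phir.
Qed.

End TensorOfLocalization.

Theorem lemma4p8 (k : comPzRingType) (lambda : k)
    (A B : comRBAlgType lambda) (f : rb_hom A B)
    (S : set A) (multS : mult_subset S)
    (SA : rb_localization S) (TB : rb_localization (f @` S))
    (Q : rb_tensor (loc_map SA) f) :
  exists phi : rb_hom Q TB,
    [/\ rb_iso phi,
        compatible phi,
        (forall psi : rb_hom Q TB, compatible psi -> psi =1 phi) &
        (* naturality in (A, B, f, S) *)
        forall (A' B' : comRBAlgType lambda) (f' : rb_hom A' B')
          (S' : set A') (multS' : mult_subset S')
          (SA' : rb_localization S') (TB' : rb_localization (f' @` S'))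
          (Q' : rb_tensor (loc_map SA') f')
          (phi' : rb_hom Q' TB') (compat' : compatible phi')
          (a : rb_hom A A') (b : rb_hom B B')
          (abf : b \o f =1 f' \o a) (aS : a @` S `<=` S')
          (aL : rb_hom SA SA') (bL : rb_hom TB TB') (ab : rb_hom Q Q')
          (aLP : aL \o loc_map SA =1 loc_map SA' \o a)
          (bLP : bL \o loc_map TB =1 loc_map TB' \o b)
          (abl : ab \o tensor_inl Q =1 tensor_inl Q' \o aL)
          (abr : ab \o tensor_inr Q =1 tensor_inr Q' \o b),
          bL \o phi =1 phi' \o ab].
Proof.
have QT := tensor_inr_localization Q.
have [phi [phir phiU]] := QT.2 TB (loc_map TB) (loc_mapP TB).1.
exists phi; split.
- exact: rb_localization_iso QT (loc_mapP TB) phir.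
- exact: compatible_inr.
- by move=> psi [_ psir]; exact: phiU.
move=> A' B' f' S' _ SA' TB' Q' phi' [_ phir'] a b _ _ aL bL ab _ bLP _ abr.
apply: (rb_localization_epi QT (g := rb_comp bL phi) (h := rb_comp phi' ab)).
move=> y /=.
have /= -> := phir y; have /= -> := abr y; have /= -> := phir' (b y).
exact: bLP.
Qed.
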